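(* The semi-NMF problem is not always well-posed, that is, an optimal solution of $$\min_{U \in \mathbb{R}^{m\times r},\, V \in \mathbb{R}^{r \times n}} \|M-UV\|_F^2 \quad \text{such that } V \geq 0$$ does not always exist. Specifically, for $$M = \begin{pmatrix} 1 & -1 & 0 \\ 0 & 0 & 1 \end{pmatrix},$$ one has $\operatorname{rank}_s(M) = 3$, while for $r = 2$ the infimum of $\|M-UV\|_F^2$ over $U \in \mathbb{R}^{2\times 2}$ and $V \in \mathbb{R}^{2\times 3}$ with $V \geq 0$ is equal to $0$; hence this infimum is not attained.
   Context: $\|\cdot\|_F$ is the Frobenius norm; $V \geq 0$ means that $V$ is component-wise nonnegative. The semi-nonnegative rank $\operatorname{rank}_s(M)$ of $M \in \mathbb{R}^{m\times n}$ is the smallest $r$ such that there exist $U \in \mathbb{R}^{m\times r}$ and $V \in \mathbb{R}^{r\times n}$ with $M = UV$ and $V \geq 0$. *)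

(* Defs.v *)
From mathcomp Require Import all_boot all_order all_algebra.
From mathcomp Require Import all_classical all_reals.

Set Implicit Arguments.
Unset Strict Implicit.
Unset Printing Implicit Defensive.

Import Order.TTheory GRing.Theory Num.Theory.

Local Open Scope classical_set_scope.
Local Open Scope ring_scope.

Definition frob_norm (R : realType) (m n : nat) (A : 'M[R]_(m, n)) : R :=
  Num.sqrt (\sum_i \sum_j A i j ^+ 2).

Definition semi_nonneg_factorizable (R : realType) (m n : nat)
    (M : 'M[R]_(m, n)) (r : nat) : Prop :=
  exists (U : 'M[R]_(m, r)) (V : 'M[R]_(r, n)),
    V \is a mxOver Num.nneg /\ M = U *m V.

(* The minimum defining rank_s is taken over a nonempty set: M = M *m 1. *)
Lemma semi_nonneg_factorizable_ex (R : realType) (m n : nat)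
    (M : 'M[R]_(m, n)) : exists r, `[< semi_nonneg_factorizable M r >].
Proof.
exists n; apply/asboolP; exists M, 1%:M; split; last by rewrite mulmx1.
by apply/mxOverP => i j; rewrite !mxE nnegrE ler0n.
Qed.

Definition rank_s (R : realType) (m n : nat) (M : 'M[R]_(m, n)) : nat :=
  ex_minn (semi_nonneg_factorizable_ex M).

Definition semi_nmf_obj (R : realType) (m n r : nat) (M : 'M[R]_(m, n))
    (U : 'M[R]_(m, r)) (V : 'M[R]_(r, n)) : R :=
  frob_norm (M - U *m V) ^+ 2.

Definition semi_nmf_optimal (R : realType) (m n r : nat) (M : 'M[R]_(m, n))
    (U : 'M[R]_(m, r)) (V : 'M[R]_(r, n)) : Prop :=
  V \is a mxOver Num.nneg /\
  forall (U' : 'M[R]_(m, r)) (V' : 'M[R]_(r, n)),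
    V' \is a mxOver Num.nneg -> semi_nmf_obj M U V <= semi_nmf_obj M U' V'.

Definition semi_nmf_values (R : realType) (m n : nat) (M : 'M[R]_(m, n))
    (r : nat) : set R :=
  [set x | exists (U : 'M[R]_(m, r)) (V : 'M[R]_(r, n)),
    V \is a mxOver Num.nneg /\ x = semi_nmf_obj M U V].

Definition ill_posed_mx (R : realType) : 'M[R]_(2, 3) :=
  \matrix_(i < 2, j < 3)
    nth 0 (nth [::] [:: [:: 1; -1; 0]; [:: 0; 0; 1]] i) j.

(* Main.v *)
Require Import Defs.
From mathcomp Require Import all_boot all_order all_algebra.
From mathcomp Require Import all_classical all_reals.
From mathcomp Require Import ring.

(** The first two columns of [M] are opposite and nonzero, so in an exact
    factorization [M = U V] the sum [w] of the first two columns of [V] is a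
    nonzero nonnegative vector of the kernel of [U]; but [M] has rank 2, so for
    [r = 2] the matrix [U] is invertible. On the other hand, tilting the two
    opposite directions to [(1, e)] and [(-1, e)] lets a large nonnegative
    multiple of their sum reach the third column, with error only [2 e^2]. *)

Import Order.TTheory GRing.Theory Num.Theory.

Local Open Scope ring_scope.

Lemma semi_nmf_objE (R : realType) (m n r : nat) (M : 'M[R]_(m, n))
    (U : 'M[R]_(m, r)) (V : 'M[R]_(r, n)) :
  semi_nmf_obj M U V = \sum_i \sum_j (M - U *m V) i j ^+ 2.
Proof.
rewrite /semi_nmf_obj /frob_norm sqr_sqrtr //.
by apply: sumr_ge0 => i _; apply: sumr_ge0 => j _; apply: sqr_ge0.
Qed.

Lemma semi_nmf_obj_eq0 (R : realType) (m n r : nat) (M : 'M[R]_(m, n))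
    (U : 'M[R]_(m, r)) (V : 'M[R]_(r, n)) :
  semi_nmf_obj M U V = 0 -> M = U *m V.
Proof.
have row_ge0 i : 0 <= \sum_j (M - U *m V) i j ^+ 2.
  by apply: sumr_ge0 => j _; apply: sqr_ge0.
rewrite semi_nmf_objE => /eqP; rewrite psumr_eq0 // => /allP rows0.
apply/eqP; rewrite -subr_eq0; apply/eqP/matrixP => i j; rewrite [RHS]mxE.
have := rows0 i (mem_index_enum i).
rewrite psumr_eq0 => [/allP entries0|k _]; last exact: sqr_ge0.
by have := entries0 j (mem_index_enum j); rewrite sqrf_eq0 => /eqP.
Qed.

Lemma ill_posed_not_factorizable (R : realType) (r : nat) :
  semi_nonneg_factorizable (ill_posed_mx R) r -> (2 < r)%N.
Proof.
case=> U [V [/mxOverP V_ge0 MUV]].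
(* [N] selects the first and third columns of the matrix, which form the identity. So [V *m N] is a
   right inverse of [U], which forces [2 <= r]. *)
pose N : 'M[R]_(3, 2) := \matrix_(i, j)
  nth 0 (nth [::] [:: [:: 1; 0]; [:: 0; 0]; [:: 0; 1]] i) j.
have UVN1 : U *m (V *m N) = 1%:M.
  rewrite mulmxA -MUV; apply/matrixP => i j.
  rewrite !mxE !big_ord_recr big_ord0 !mxE /=.
  by case: i => [[|[|//]] ?]; case: j => [[|[|//]] ?] /=;
    rewrite ?(mulr0, mulr1, addr0, add0r).
have r_ge2 : (2 <= r)%N := mulmx1_min UVN1.
rewrite ltn_neqAle r_ge2 andbT; apply/eqP => r_eq2.
case: r / r_eq2 U V V_ge0 MUV UVN1 {r_ge2} => U V V_ge0 MUV UVN1.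
(* With [r] replaced by 2, [U] is square: its right inverse is also a left inverse, so its kernel is
   trivial. *)
have VNU1 := mulmx1C UVN1.
pose w : 'cV[R]_2 := col 0 V + col 1 V.
have Uw0 : U *m w = 0.
  rewrite mulmxDr !colE !mulmxA -MUV -!colE; apply/matrixP => i j.
  by rewrite !mxE; case: i => [[|[|//]] ?] /=; rewrite ?subrr ?addr0.
have w0 : w = 0 by rewrite -[w]mul1mx -VNU1 -mulmxA Uw0 mulmx0.
(* Nonnegative entries with zero sum all vanish. *)
have V00 : col 0 V = 0.
  apply/matrixP => i j; move/matrixP: w0 => /(_ i j); rewrite !mxE => /eqP.
  by rewrite paddr_eq0 -?nnegrE ?V_ge0 // => /andP[/eqP].
have /matrixP/(_ 0 0) : col 0 (ill_posed_mx R) = 0.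
  by rewrite MUV colE -mulmxA -colE V00 mulmx0.
by rewrite !mxE /= => /eqP; rewrite oner_eq0.
Qed.

Lemma rank_s_ill_posed (R : realType) : rank_s (ill_posed_mx R) = 3%N.
Proof.
rewrite /rank_s; case: ex_minnP => r /asboolP fact_r min_r.
apply/eqP; rewrite eqn_leq (@ill_posed_not_factorizable R) // andbT.
apply/min_r/asboolP; exists (ill_posed_mx R), 1%:M; rewrite mulmx1; split=> //.
by apply/mxOverP => i j; rewrite !mxE nnegrE ler0n.
Qed.

Lemma ill_posed_value (R : realType) (e : R) : 0 < e ->
  semi_nmf_values (ill_posed_mx R) 2 (e ^+ 2 *+ 2).
Proof.
move=> e_gt0; have e_neq0 : e != 0 by rewrite gt_eqF.
(* The sum of the two columns of [U] is [(0, 2e)]; scaling it by [t] gives exactly the third column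
   [(0, 1)]. The only errors left are the two entries [e] of the second row. *)
pose t := (e *+ 2)^-1.
have t_ge0 : 0 <= t by rewrite invr_ge0 mulrn_wge0 // ltW.
have et1 : e * t + e * t = 1 by rewrite -mulrDl -mulr2n divff // mulrn_eq0.
exists (\matrix_(i, j) nth 0 (nth [::] [:: [:: 1; -1]; [:: e; e]] i) j).
exists (\matrix_(i, j) nth 0 (nth [::] [:: [:: 1; 0; t]; [:: 0; 1; t]] i) j).
split.
  apply/mxOverP => i j; rewrite mxE nnegrE.
  by case: i => [[|[|//]] ?]; case: j => [[|[|[|//]]] ?].
rewrite semi_nmf_objE !big_ord_recr !big_ord0 /= !mxE /=.
rewrite !big_ord_recr !big_ord0 /= !mxE /= !add0r et1.
by ring.
Qed.

(** Take [e] to be the square root of [c / 2]. Values arbitrarily close to 0 are thus reached, which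
    pins down the infimum. *)
Lemma ill_posed_value_gt0 (R : realType) (c : R) : 0 < c ->
  semi_nmf_values (ill_posed_mx R) 2 c.
Proof.
move=> c_gt0; have c2_gt0 : 0 < c / 2 by rewrite divr_gt0.
have := @ill_posed_value R (Num.sqrt (c / 2)).
rewrite sqrtr_gt0 sqr_sqrtr ?ltW // => /(_ c2_gt0).
by rewrite -mulr_natr divfK // pnatr_eq0.
Qed.

Theorem mainTheorem9 (R : realType) :
  (~ forall (m n r : nat) (M : 'M[R]_(m, n)),
       exists (U : 'M[R]_(m, r)) (V : 'M[R]_(r, n)), semi_nmf_optimal M U V) /\
  rank_s (ill_posed_mx R) = 3%N /\
  (* the library's inf is 0 by convention on sets without an infimum *)
  has_inf (semi_nmf_values (ill_posed_mx R) 2) /\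
  inf (semi_nmf_values (ill_posed_mx R) 2) = 0 /\
  ~ semi_nmf_values (ill_posed_mx R) 2
      (inf (semi_nmf_values (ill_posed_mx R) 2)).
Proof.
set S := semi_nmf_values _ 2.
have S_lb : lbound S 0 by move=> _ [U [V [_ ->]]]; apply: sqr_ge0.
have S_inf : has_inf S.
  by split; [exists 1; apply: ill_posed_value_gt0 | exists 0].
have inf0 : inf S = 0.
  apply/eqP; rewrite eq_le lb_le_inf ?andbT //; last by case: S_inf.
  apply/ler_addgt0Pl => c c_gt0; rewrite addr0.
  by apply: ge_inf; [case: S_inf | apply: ill_posed_value_gt0].
have S0 : ~ S 0.
  case=> U [V [V_ge0 /esym /semi_nmf_obj_eq0 MUV]].
  suff : (2 < 2)%N by [].
  by apply: (@ill_posed_not_factorizable R); exists U, V.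
split; last by rewrite inf0 rank_s_ill_posed.
move=> /(_ 2%N 3%N 2%N (ill_posed_mx R)) [U [V [V_ge0 UV_min]]].
(* The value of an optimal pair is a lower bound of [S], so it would be 0, a value that is not
   attained. *)
have : semi_nmf_obj (ill_posed_mx R) U V <= inf S.
  apply: lb_le_inf => [|_ [U' [V' [V'_ge0 ->]]]]; first by case: S_inf.
  exact: UV_min.
rewrite inf0 => obj_le0; apply: S0; exists U, V; split=> //.
by apply/eqP; rewrite eq_le sqr_ge0.
Qed.
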